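(* Let the fundamental diagram be triangular, let $x_m=x_0+m\Delta x$ for $m\in\{0,\dots,n_{ini}\}$, and let $\Delta t\le\frac{\Delta x}{v}$. For any discrete time $t=i\cdot\Delta t$ with $i\in\mathbb{N}$, $i\ge1$, we have $$N(x_{n_{ini}},t)=\begin{cases}\min\left(N_{c_{ini}^{l}}(x_{n_{ini}},t),\,N_{c_{ini}^{l+1}}(x_{n_{ini}},t),\,N_{c_{down}^{j}}(x_{n_{ini}},(i-1)\Delta t)+v\,k_c\,\Delta t\right) & \text{if } t\le\frac{x_{n_{ini}}-x_0}{v},\\[1ex] \min\left(N_{c_{down}^{j}}(x_{n_{ini}},(i-1)\Delta t)+v\,k_c\,\Delta t,\,N_{c_{up}^{k}}(x_{n_{ini}},t)\right) & \text{otherwise,}\end{cases}$$ where $j=i-1$, $k=\left\lfloor\frac{t-\frac{x_{n_{ini}}-x_0}{v}}{\Delta t}\right\rfloor$ and $l=\left\lfloor\frac{vt}{\Delta x}\right\rfloor$.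
   Context: Triangular fundamental diagram: $Q(k)=vk$ for $0\le k\le k_c$ and $Q(k)=-w(k-k_{jam})$ for $k_c\le k\le k_{jam}$, with $v,w>0$, $0<k_c<k_{jam}$ and $vk_c=-w(k_c-k_{jam})$. Its convex transform is $R(u)=\sup_{k\in[0,k_{jam}]}(Q(k)-uk)=k_c(v-u)$ for $u\in[-w,v]$. The road link is $[x_0,x_{n_{ini}}]$; $\Delta x,\Delta t>0$ are the space and time steps. Initial blocks, imposed at time $0$: for $m\in\{0,\dots,n_{ini}-1\}$, $c_{ini}^m(x)=-k_mx+b_m$ on $[x_m,x_{m+1}]$ and $+\infty$ otherwise, with $0\le k_m\le k_{jam}$ and, for $m\le n_{ini}-2$, $c_{ini}^m(x_{m+1})=c_{ini}^{m+1}(x_{m+1})$. With $t_m=m\Delta t$, $m\ge0$, the upstream blocks (imposed at $x_0$) are $c_{up}^m(t)=q_mt+d_m$ and the downstream blocks (imposed at $x_{n_{ini}}$) are $c_{down}^m(t)=p_mt+c_m$ on $[t_m,t_{m+1}]$, $+\infty$ otherwise, with $0\le q_m,p_m\le vk_c$. Initial, upstream and downstream data together are continuous (consecutive blocks agree at common endpoints, and boundary data agree with the initial data at time $0$ at $x_0$ and $x_{n_{ini}}$). For data $c$ prescribed on a set of points $(y,s)$ of the boundary of the space-time domain, the associated solution component is given by the Lax-Hopf formula $$N_c(x,t)=\inf\{c(y,s)+(t-s)R(\tfrac{x-y}{t-s}) : (y,s)\in\mathrm{Dom}(c),\ s<t,\ -w\le\tfrac{x-y}{t-s}\le v\},$$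 where also $(y,s)=(x,t)$ is admitted, with value $c(x,t)$, if $(x,t)\in\mathrm{Dom}(c)$; the infimum over the empty set is $+\infty$. In particular $N_{c_{ini}^m}$, $N_{c_{up}^m}$, $N_{c_{down}^m}$ are the components of single blocks; components with an index outside the range of existing blocks are taken to be $+\infty$. $N(x_{n_{ini}},i\Delta t)$ is the value used to compute the demand of the link over $[(i-1)\Delta t,i\Delta t]$, when the downstream flow over this last interval is not yet prescribed: it is the minimum of the components at $(x_{n_{ini}},i\Delta t)$ of all initial blocks, of all upstream data, and of the downstream data restricted to times $[0,(i-1)\Delta t]$. The prescribed downstream flows are the actual flows given by a junction model and so never exceed the demand: $c_{down}(m\Delta t)\le N(x_{n_{ini}},m\Delta t)$ for all $m\ge1$, where $c_{down}=\min_m c_{down}^m$. Likewise upstream flows never exceed the supply: with $c_{up}=\min_m c_{up}^m$, $c_{up}(m\Delta t)$ is at most the minimum of the components at $(x_0,m\Delta t)$ of all initial blocks, all downstream data, and the upstream data restricted to $[0,(m-1)\Delta t]$.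
   Formalization: The index l is taken as n_ini − 1 − ⌊vt/Δx⌋ instead of ⌊vt/Δx⌋: the floor counts blocks from the downstream end, and with blocks numbered from upstream the printed formula fails (e.g. n_ini = 1, v = w = k_c = Δx = Δt = 1, k_jam = 2, zero data, i = 1). *)

(* Defs.v *)
From mathcomp Require Import all_boot all_order all_algebra.
From mathcomp Require Import boolp classical_sets reals constructive_ereal ereal.

Set Implicit Arguments.
Unset Strict Implicit.
Unset Printing Implicit Defensive.

Import Order.TTheory GRing.Theory Num.Theory.

Local Open Scope classical_set_scope.
Local Open Scope ring_scope.

Record fundamental_diagram (R : realType) := FundamentalDiagram {
  v : R;     (* free-flow speed *)
  w : R;     (* congestion speed, counted positively *)
  kc : R;    (* critical density *)
  kjam : R   (* jam density *)
}.

Definition triangular (R : realType) (fd : fundamental_diagram R) : Prop :=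
  [/\ 0 < v fd, 0 < w fd, 0 < kc fd, kc fd < kjam fd
    & v fd * kc fd = - w fd * (kc fd - kjam fd)].

Definition flow (R : realType) (fd : fundamental_diagram R) (k : R) : R :=
  if k <= kc fd then v fd * k else - w fd * (k - kjam fd).

Definition convex_transform (R : realType) (fd : fundamental_diagram R)
    (u : R) : R :=
  sup [set flow fd k - u * k | k in [set k : R | 0 <= k <= kjam fd]].

(* Partial data on the space-time plane: a point (position, time) at which
   nothing is prescribed is sent to +oo. *)
Definition data (R : realType) := R * R -> \bar R.

Definition Dom (R : realType) (c : data R) : set (R * R) :=
  [set z | c z != +oo%E].

Definition lax_hopf (R : realType) (fd : fundamental_diagram R) (c : data R)
    (x t : R) : \bar R :=
  ereal_inf
    ([set (c z + ((t - z.2)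
                  * convex_transform fd ((x - z.1) / (t - z.2)))%:E)%E
       | z in [set z | [/\ Dom c z, z.2 < t
                         & - w fd <= (x - z.1) / (t - z.2) <= v fd]]]
     `|` [set c z | z in Dom c `&` [set (x, t)]]).

Record link (R : realType) := Link {
  fdiag :> fundamental_diagram R;
  nini : nat;          (* number of initial blocks *)
  node : nat -> R;     (* x_0, ..., x_nini; later values are irrelevant *)
  dt : R;              (* time step *)
  kini : nat -> R; bini : nat -> R;   (* initial:    - kini m * x + bini m *)
  qup : nat -> R; dup : nat -> R;     (* upstream:   qup m * t + dup m *)
  pdown : nat -> R; cdown : nat -> R  (* downstream: pdown m * t + cdown m *)
}.

Section LinkData.
Variables (R : realType) (D : link R).

Definition xin : R := node D 0.
Definition xout : R := node D (nini D).
Definition time (m : nat) : R := m%:R * dt D.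

(* The blocks as functions of the position, resp. of the time. *)
Definition ini_fun (m : nat) (x : R) : \bar R :=
  if (m < nini D)%N && (node D m <= x <= node D m.+1)
  then (- kini D m * x + bini D m)%:E else +oo%E.

Definition up_fun (m : nat) (t : R) : \bar R :=
  if time m <= t <= time m.+1 then (qup D m * t + dup D m)%:E else +oo%E.

Definition down_fun (m : nat) (t : R) : \bar R :=
  if time m <= t <= time m.+1 then (pdown D m * t + cdown D m)%:E else +oo%E.

Definition up_data (t : R) : \bar R := ereal_inf (range (up_fun ^~ t)).
Definition down_data (t : R) : \bar R := ereal_inf (range (down_fun ^~ t)).

Definition initially (f : R -> \bar R) : data R :=
  fun z => if z.2 == 0 then f z.1 else +oo%E.

Definition imposed_at (y : R) (f : R -> \bar R) : data R :=
  fun z => if z.1 == y then f z.2 else +oo%E.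

Definition up_to (tau : R) (f : R -> \bar R) : R -> \bar R :=
  fun t => if 0 <= t <= tau then f t else +oo%E.

Definition ini_block (m : nat) : data R := initially (ini_fun m).
Definition up_block (m : nat) : data R := imposed_at xin (up_fun m).
Definition down_block (m : nat) : data R := imposed_at xout (down_fun m).

(* Solution component of the block of index m of a family. The index is an
   integer so that indices below the range also give +oo; ini_block is empty,
   hence of component +oo, from the index nini on. *)
Definition component (B : nat -> data R) (m : int) (x t : R) : \bar R :=
  if m is Posz m' then lax_hopf D (B m') x t else +oo%E.

Definition N_ini (m : int) := component ini_block m.
Definition N_up (m : int) := component up_block m.
Definition N_down (m : int) := component down_block m.

Definition admissible_blocks : Prop :=
  [/\ forall m, (m < nini D)%N -> 0 <= kini D m <= kjam D,
      forall m, 0 <= qup D m <= v D * kc D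
    & forall m, 0 <= pdown D m <= v D * kc D].

Definition continuous_data : Prop :=
  [/\ forall m, (m.+1 < nini D)%N ->
        ini_fun m (node D m.+1) = ini_fun m.+1 (node D m.+1),
      forall m, up_fun m (time m.+1) = up_fun m.+1 (time m.+1),
      forall m, down_fun m (time m.+1) = down_fun m.+1 (time m.+1),
      up_fun 0 0 = ini_fun 0 xin
    & down_fun 0 0 = ini_fun (nini D).-1 xout].

Definition ini_value (x t : R) : \bar R :=
  \big[Order.min/+oo%E]_(m < nini D) lax_hopf D (ini_block m) x t.

(* Values at the two ends of the link at the i-th time step (i >= 1), when the
   flow through that end over the last step is not yet prescribed. *)
Definition demand_value (i : nat) : \bar R :=
  Order.min (ini_value xout (time i))
    (Order.min (lax_hopf D (imposed_at xin up_data) xout (time i))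
      (lax_hopf D (imposed_at xout (up_to (time i.-1) down_data))
         xout (time i))).

Definition supply_value (i : nat) : \bar R :=
  Order.min (ini_value xin (time i))
    (Order.min (lax_hopf D (imposed_at xout down_data) xin (time i))
      (lax_hopf D (imposed_at xin (up_to (time i.-1) up_data))
         xin (time i))).

Definition junction_flows : Prop :=
  forall m, (0 < m)%N ->
    (down_data (time m) <= demand_value m)%E /\
    (up_data (time m) <= supply_value m)%E.

End LinkData.

(* Main.v *)
Require Import Defs.
From mathcomp Require Import all_boot all_order all_algebra.
From mathcomp Require Import boolp classical_sets reals constructive_ereal ereal.
From mathcomp Require Import ring lra zify.

(** With a triangular diagram the convex transform is affine, so the Lax-Hopf
    cost from (y, s) to (x, t) is [kc * (v * (t - s) - (x - y))]: it vanishes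
    along free-flow characteristics, and for a fixed observer position x it
    grows at the capacity rate [v * kc]. Three facts then decide which data can
    attain the minimum at the downstream end.

    - Boundary flows are at most the capacity. So, along either boundary, the
      value plus the cost is nonincreasing in the time of emission, and only
      the latest admissible datum matters: the one of time [(i-1) dt]
      downstream ([down_component]), and the one on the free-flow
      characteristic upstream ([glued_slope]).

    - The prescribed downstream datum at time [(i-1) dt] is at most the demand
      at that time, hence at most the contribution of every initial point y
      that could already reach the exit then, that is [xout - y <= v (i-1) dt].
      One time step adds [v kc dt] to both sides, so these points are dominated
      by the downstream term ([junction_covers]).

    - The remaining initial points lie in the strip
      [xout - v t <= y < xout - v (t - dt)], whose width is at most [dx] by the
      CFL condition. As long as [t <= (xout - xin) / v] the strip meets at most the blocks l and l + 1
      ([floor_two_blocks]). Afterwards it meets at most block 0, on which the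
      contribution is affine in y, hence bounded below by the smaller of its
      values at two points: the inlet, where the upstream term is no larger
      because the data are continuous and the inflow is at most the capacity,
      and the edge of the strip, which the downstream term dominates. *)

Set Implicit Arguments.
Unset Strict Implicit.
Unset Printing Implicit Defensive.

Import Order.TTheory GRing.Theory Num.Theory.
Local Open Scope ring_scope.

(** * The Lax-Hopf formula for a triangular diagram *)

(** The supremum is attained at the critical density: below it the slope
    [v - u] of [flow k - u * k] is nonnegative, above it the slope [- w - u] is
    nonpositive. *)
Lemma convex_transformE (R : realType) (fd : fundamental_diagram R) (u : R) :
  triangular fd -> - w fd <= u <= v fd ->
  convex_transform fd u = kc fd * (v fd - u).
Proof.
move=> [v0 w0 kc0 kcj vk] /andP[wu uv].
have ub : ubound [set flow fd k - u * k | k in [set k : R | 0 <= k <= kjam fd]]%classic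
    (kc fd * (v fd - u)).
  move=> _ [k /= /andP[k0 kj] <-]; rewrite /flow.
  case: ifPn => [kkc|]; first by nra.
  by rewrite -ltNge => kck; nra.
apply/le_anti/andP; split.
  apply: ge_sup ub; exists (flow fd 0 - u * 0), 0 => //=.
  by rewrite lexx (ltW (lt_trans kc0 kcj)).
apply: ub_le_sup; first by exists (kc fd * (v fd - u)).
exists (kc fd); first by rewrite /= (ltW kc0) (ltW kcj).
by rewrite /flow lexx; ring.
Qed.

(** The perspective [(t - s) * convex_transform ((x - y) / (t - s))] of the
    convex transform, cleared of its division so that it also makes sense, and
    is 0, when (y, s) = (x, t). *)
Definition travel_cost (R : realType) (fd : fundamental_diagram R)
  (x t y s : R) : R := kc fd * (v fd * (t - s) - (x - y)).

(** The speed constraint of the Lax-Hopf formula, again without the division.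
    As [v + w > 0] it entails [s <= t], with [y = x] if [s = t]: it covers both
    the strictly earlier points and the point (x, t) itself. *)
Definition reaches (R : realType) (fd : fundamental_diagram R)
  (x t y s : R) : bool := - w fd * (t - s) <= x - y <= v fd * (t - s).

Lemma reaches_le (R : realType) (fd : fundamental_diagram R) (x t y s : R) :
  triangular fd -> reaches fd x t y s -> s <= t.
Proof. by move=> [v0 w0 _ _ _] /andP[]; nra. Qed.

(** Both parts of the defining infimum become a single quantification over the
    backward cone. Points where nothing is prescribed may be included: their
    value +oo is above any bound. *)
Lemma lax_hopf_geP (R : realType) (fd : fundamental_diagram R) (c : data R)
    (x t : R) (M : \bar R) : triangular fd ->
  (M <= lax_hopf fd c x t)%E <->
  forall y s, reaches fd x t y s ->
    (M <= c (y, s) + (travel_cost fd x t y s)%:E)%E.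
Proof.
move=> tri; split.
  move=> /ereal_infP le_inf y s cone.
  have [cy|cy] := eqVneq (c (y, s)) +oo%E; first by rewrite cy addye // leey.
  have := reaches_le tri cone; rewrite le_eqVlt => /orP[/eqP st|st].
    have xy : y = x by move: cone; rewrite /reaches st; lra.
    rewrite /travel_cost st xy !subrr mulr0 subrr mulr0 adde0.
    by apply: le_inf; right; exists (x, t); rewrite // -st -xy.
  have ts0 : 0 < t - s by rewrite subr_gt0.
  have u_range : - w fd <= (x - y) / (t - s) <= v fd.
    by rewrite ler_pdivlMr // ler_pdivrMr.
  have -> : travel_cost fd x t y s
      = (t - s) * convex_transform fd ((x - y) / (t - s)).
    by rewrite convex_transformE // /travel_cost; field; rewrite gt_eqF.
  by apply: le_inf; left; exists (y, s).
move=> lb; apply/ereal_infP => z [[[y s] /= [_ st u_range] <-]|].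
  have ts0 : 0 < t - s by rewrite subr_gt0.
  have -> : (t - s) * convex_transform fd ((x - y) / (t - s))
      = travel_cost fd x t y s.
    by rewrite convex_transformE // /travel_cost; field; rewrite gt_eqF.
  by apply: lb; rewrite /reaches -(ler_pdivlMr _ _ ts0) -(ler_pdivrMr _ _ ts0).
move=> [p [_ ->] <-].
have := lb x t; rewrite /travel_cost /reaches !subrr !mulr0 subrr mulr0 adde0.
by apply; rewrite lexx.
Qed.

Lemma lax_hopf_le (R : realType) (fd : fundamental_diagram R) (c : data R)
    (x t y s : R) : triangular fd -> reaches fd x t y s ->
  (lax_hopf fd c x t <= c (y, s) + (travel_cost fd x t y s)%:E)%E.
Proof. by move=> tri; apply: (lax_hopf_geP c x t _ tri).1. Qed.

Lemma lax_hopf_mono (R : realType) (fd : fundamental_diagram R)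
    (c c' : data R) (x t : R) : triangular fd ->
  (forall z, c z <= c' z)%E -> (lax_hopf fd c x t <= lax_hopf fd c' x t)%E.
Proof.
move=> tri cc'; apply/(lax_hopf_geP c' x t _ tri) => y s cone.
by apply: le_trans (lax_hopf_le c tri cone) _; apply: leeD2r.
Qed.

(** * Data prescribed block by block in time *)

Section TimeBlocks.
Variables (R : realType) (D : link R).
Hypothesis dt_gt0 : 0 < dt D.

(** The common shape of the upstream and of the downstream blocks. *)
Definition affine_block (a b : nat -> R) (m : nat) (s : R) : \bar R :=
  if time D m <= s <= time D m.+1 then (a m * s + b m)%:E else +oo%E.

Lemma time_le m n : (time D m <= time D n) = (m <= n)%N.
Proof. by rewrite ler_pM2r // ler_nat. Qed.

Lemma timeS m : time D m.+1 = time D m + dt D.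
Proof. by rewrite /time -natr1 mulrDl mul1r. Qed.

Lemma time_ge0 m : 0 <= time D m.
Proof. by rewrite mulr_ge0 ?ler0n // ltW. Qed.

Lemma time_block_of_floor m (s : R) :
  Num.floor (s / dt D) = m%:Z -> time D m <= s <= time D m.+1.
Proof.
move=> sm; have := floor_itv (s / dt D); rewrite sm -PoszD addn1 ler_pdivlMr //.
by rewrite ltr_pdivrMr // => /andP[-> /ltW].
Qed.

Variables (a b : nat -> R).
Hypothesis cont : forall m,
  affine_block a b m (time D m.+1) = affine_block a b m.+1 (time D m.+1).

Lemma blocks_agree m : a m * time D m.+1 + b m
  = a m.+1 * time D m.+1 + b m.+1.
Proof. by have := cont m; rewrite /affine_block !time_le !leqnn !leqnSn /= => -[]. Qed.

(** Distinct blocks that contain s are consecutive and share s as an endpoint,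
    where continuity makes them agree; so the minimum over all blocks is read
    off any block containing s. *)
Lemma glued_block m s : time D m <= s <= time D m.+1 ->
  ereal_inf (range (affine_block a b ^~ s)) = (a m * s + b m)%:E.
Proof.
move=> ms; apply/le_anti/andP; split.
  by apply: ereal_inf_lbound; exists m => //=; rewrite /affine_block ms.
apply/ereal_infP => _ [m' _ <-]; rewrite /affine_block.
case: ifPn => [m's|_]; last exact: leey.
suff agree p q : (p < q)%N -> time D p <= s <= time D p.+1 ->
    time D q <= s <= time D q.+1 -> a p * s + b p = a q * s + b q.
  rewrite lee_fin; case: (ltngtP m m') => [mm'|m'm|->] //.
    by rewrite (agree _ _ mm').
  by rewrite (agree _ _ m'm).
move=> pq /andP[_ sp] /andP[qs _].
have qp : q = p.+1.
  by apply/eqP; rewrite eqn_leq pq andbT -time_le (le_trans qs).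
have -> : s = time D p.+1 by apply/le_anti; rewrite sp -qp qs.
by rewrite qp blocks_agree.
Qed.

Lemma glued_lt0 (s : R) : s < 0 ->
  ereal_inf (range (affine_block a b ^~ s)) = +oo%E.
Proof.
move=> s0; apply/le_anti; rewrite leey; apply/ereal_infP => _ [m _ <-].
by rewrite /affine_block ifN //= leNgt (lt_le_trans s0 (time_ge0 m)).
Qed.

(** Chaining the affine pieces: a bound on all the slopes bounds the increments
    of the glued data. At negative times nothing is prescribed and the right
    side is +oo. *)
Lemma glued_slope (C s1 s2 : R) : (forall m, a m <= C) -> s1 <= s2 ->
  (ereal_inf (range (affine_block a b ^~ s2))
   <= ereal_inf (range (affine_block a b ^~ s1)) + (C * (s2 - s1))%:E)%E.
Proof.
move=> aC s12; have [s1_lt0|s1_ge0] := ltP s1 0.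
  by rewrite (glued_lt0 s1_lt0) addye // leey.
have block s : 0 <= s ->
    time D (Num.truncn (s / dt D)) <= s <= time D (Num.truncn (s / dt D)).+1.
  move=> s0; have sdt0 : 0 <= s / dt D by rewrite divr_ge0 // ltW.
  have := truncn_itv sdt0; rewrite ler_pdivlMr // ltr_pdivrMr //.
  by move=> /andP[-> /ltW].
have ms1 := block _ s1_ge0.
have ns2 := block _ (le_trans s1_ge0 s12).
have mn : (Num.truncn (s1 / dt D) <= Num.truncn (s2 / dt D))%N.
  by apply: le_truncn; rewrite ler_pM2r // invr_gt0.
move: {block} (Num.truncn _) (Num.truncn _) mn ms1 ns2 => n m mn ms1 ns2.
rewrite (glued_block ms1) (glued_block ns2) lee_fin.
move: mn s2 s12 ns2 => /subnK <-; elim: (n - m)%N => [|d IH] s2 s12.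
  by rewrite add0n => _; have := aC m; nra.
rewrite addSn => /andP[ns2 s2n].
have s1d : s1 <= time D (d + m).+1.
  by case/andP: ms1 => _ /le_trans; apply; rewrite time_le ltnS leq_addl.
have := IH _ s1d; rewrite !time_le leqnn leqnSn blocks_agree.
by move=> /(_ isT); have := aC (d + m).+1; nra.
Qed.

End TimeBlocks.

(** * Components of the initial, upstream and downstream data *)

Definition ini_affine (R : realType) (D : link R) (m : nat) (y : R) : R :=
  - kini D m * y + bini D m.

Definition in_block (R : realType) (D : link R) (m : nat) (y : R) : bool :=
  (m < nini D)%N && (node D m <= y <= node D m.+1).

Lemma N_ini_le (R : realType) (D : link R) (m : nat) (x t y : R) :
  triangular D -> in_block D m y -> reaches D x t y 0 ->
  (N_ini D m x t <= (ini_affine D m y + travel_cost D x t y 0)%:E)%E.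
Proof.
move=> tri my cone; apply: le_trans (lax_hopf_le _ tri cone) _.
by rewrite /ini_block /initially /= eqxx /ini_fun -/(in_block D m y) my EFinD.
Qed.

Lemma ini_value_le_N_ini (R : realType) (D : link R) (z : int) (x t : R) :
  triangular D -> (ini_value D x t <= N_ini D z x t)%E.
Proof.
move=> tri; case: z => [m|m]; last exact: leey.
case: (ltnP m (nini D)) => [mn|nm]; first exact: (bigmin_le _ (Ordinal mn)).
apply/(lax_hopf_geP _ _ _ _ tri) => y s _.
rewrite /ini_block /initially /ini_fun /= ltnNge nm /= if_same addye //.
exact: leey.
Qed.

Lemma ini_value_ge (R : realType) (D : link R) (x t : R) (M : \bar R) :
  triangular D ->
  (forall m y, in_block D m y -> reaches D x t y 0 ->
     (M <= (ini_affine D m y + travel_cost D x t y 0)%:E)%E) ->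
  (M <= ini_value D x t)%E.
Proof.
move=> tri lb; apply: le_bigmin => [|m _]; first exact: leey.
apply/(lax_hopf_geP _ _ _ _ tri) => y s.
rewrite /ini_block /initially /ini_fun /= -/(in_block D m y).
case: eqVneq => [->|_]; last by rewrite addye // leey.
by case: ifPn => [my|_]; [exact: lb|rewrite addye // leey].
Qed.

(** At the initial time of a downstream block the cone meets the block only in
    its first point. *)
Lemma N_down_start (R : realType) (D : link R) (p : nat) :
  triangular D -> 0 < dt D ->
  N_down D p (xout D) (time D p) = (pdown D p * time D p + cdown D p)%:E.
Proof.
move=> tri dt0; apply/le_anti/andP; split.
  have cone : reaches D (xout D) (time D p) (xout D) (time D p).
    by rewrite /reaches !subrr !mulr0 lexx.
  apply: le_trans (lax_hopf_le _ tri cone) _.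
  rewrite /down_block /imposed_at /down_fun /travel_cost /= eqxx.
  by rewrite !subrr mulr0 subrr mulr0 adde0 !time_le // leqnn leqnSn.
apply/(lax_hopf_geP _ _ _ _ tri) => y s cone.
have sp := reaches_le tri cone.
rewrite /down_block /imposed_at /down_fun /travel_cost /=.
case: eqVneq => [->|_]; last by rewrite addye // leey.
case: ifPn => [/andP[ps _]|_]; last by rewrite addye // leey.
have -> : s = time D p by apply/le_anti; rewrite sp ps.
by rewrite !subrr mulr0 subrr mulr0 adde0.
Qed.

(** An initial point that reaches the exit by [time p] contributes to the demand
    at [time p], which the prescribed downstream value does not exceed. At time 0,
    where the junction imposes nothing, the only such point is the exit itself,
    and continuity of the data applies. *)
Lemma junction_covers (R : realType) (D : link R) (dx : R) (p m : nat) (y : R) :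
  triangular D -> 0 < dx -> 0 < dt D ->
  (forall m, (m <= nini D)%N -> node D m = xin D + m%:R * dx) ->
  continuous_data D -> junction_flows D ->
  in_block D m y -> xout D - y <= v D * time D p ->
  pdown D p * time D p + cdown D p
  <= ini_affine D m y + travel_cost D (xout D) (time D p) y 0.
Proof.
move=> tri dx0 dt0 grid [_ _ cdn _ c0n] junc my yp.
have /andP[mn /andP[ym ym1]] := my.
have y_out : y <= xout D.
  by rewrite (le_trans ym1) // /xout !grid // lerD2l ler_pM2r // ler_nat.
have [v0 w0 kc0 _ _] := tri.
have tp : time D p <= time D p <= time D p.+1 by rewrite !time_le // leqnn leqnSn.
case: p yp tp => [|p] yp tp.
  have {yp} y_xout : y = xout D.
    by move: yp; rewrite /time mul0r; lra.
  have m_last : m = (nini D).-1.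
    apply/eqP; rewrite -eqSS prednK ?(leq_ltn_trans _ mn) // eqn_leq mn /=.
    by move: ym1; rewrite y_xout /xout !grid // lerD2l ler_pM2r // ler_nat.
  move: c0n; rewrite /down_fun /ini_fun -m_last -/(in_block D m (xout D)).
  rewrite -y_xout my; move: tp; rewrite /time mul0r => -> [->].
  by rewrite y_xout /travel_cost !subrr mulr0 subrr mulr0 addr0 lexx.
have cone : reaches D (xout D) (time D p.+1) y 0.
  rewrite /reaches subr0 yp andbT.
  by have := time_ge0 dt0 p.+1; nra.
have [+ _] := junc p.+1 isT.
rewrite /down_data (glued_block dt0 cdn tp) => /le_trans le_dem.
rewrite -lee_fin; apply: le_dem; rewrite /demand_value ge_min.
apply/orP; left; apply: le_trans (N_ini_le tri my cone).
exact: ini_value_le_N_ini.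
Qed.

(** Waiting at the exit costs [v * kc] per unit of time, at least the slope of
    the downstream data: the latest prescribed datum gives the minimum. *)
Lemma down_component (R : realType) (D : link R) (p : nat) :
  triangular D -> 0 < dt D -> admissible_blocks D -> continuous_data D ->
  lax_hopf D (imposed_at (xout D) (up_to (time D p) (down_data D)))
    (xout D) (time D p.+1)
  = (pdown D p * time D p + cdown D p + v D * kc D * dt D)%:E.
Proof.
move=> tri dt0 [_ _ adm] [_ _ cdn _ _].
have [v0 w0 kc0 _ _] := tri.
have tp : time D p <= time D p <= time D p.+1 by rewrite !time_le // leqnn leqnSn.
apply/le_anti/andP; split.
  have cone : reaches D (xout D) (time D p.+1) (xout D) (time D p).
    by rewrite /reaches timeS; apply/andP; split; nra.
  apply: le_trans (lax_hopf_le _ tri cone) _.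
  rewrite /imposed_at /up_to /= eqxx (time_ge0 dt0) lexx /=.
  rewrite /down_data (glued_block dt0 cdn tp) /travel_cost timeS lee_fin.
  by lra.
apply/(lax_hopf_geP _ _ _ _ tri) => y s cone.
rewrite /imposed_at /up_to /=.
case: eqVneq => [->|_]; last by rewrite addye // leey.
case: ifPn => [/andP[s0 sp]|_]; last by rewrite addye // leey.
have le_C m : pdown D m <= v D * kc D by case/andP: (adm m).
have := glued_slope dt0 cdn le_C sp; rewrite (glued_block dt0 cdn tp).
move=> /(leeD2r (v D * kc D * dt D)%:E); rewrite -EFinD => /le_trans; apply.
rewrite -addeA -EFinD; apply: leeD2l; rewrite lee_fin /travel_cost timeS.
by lra.
Qed.

(** The upstream data are the minimum of their blocks. *)
Lemma up_component_le (R : realType) (D : link R) (z : int) (x t : R) :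
  triangular D ->
  (lax_hopf D (imposed_at (xin D) (up_data D)) x t <= N_up D z x t)%E.
Proof.
move=> tri; case: z => [m|m]; last exact: leey.
apply: lax_hopf_mono => // -[y s]; rewrite /imposed_at /up_block /imposed_at /=.
by case: eqP => // _; apply: ereal_inf_lbound; exists m.
Qed.

(** * The demand of the link *)

Lemma demand_value_ge (R : realType) (D : link R) (p : nat) (M : \bar R) :
  triangular D -> 0 < dt D -> admissible_blocks D -> continuous_data D ->
  (forall m y, in_block D m y -> reaches D (xout D) (time D p.+1) y 0 ->
     (M <= (ini_affine D m y
            + travel_cost D (xout D) (time D p.+1) y 0)%:E)%E) ->
  (forall s, reaches D (xout D) (time D p.+1) (xin D) s ->
     (M <= up_data D s
           + (travel_cost D (xout D) (time D p.+1) (xin D) s)%:E)%E) ->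
  (M <= (pdown D p * time D p + cdown D p + v D * kc D * dt D)%:E)%E ->
  (M <= demand_value D p.+1)%E.
Proof.
move=> tri dt0 adm con le_ini le_up le_down.
rewrite /demand_value /= !le_min down_component // le_down andbT.
rewrite ini_value_ge //=; apply/(lax_hopf_geP _ _ _ _ tri) => y s.
rewrite /imposed_at /=; case: eqVneq => [->|_]; first exact: le_up.
by rewrite addye // leey.
Qed.

(** Positions are measured from the downstream end in units of the block length.
    The hypotheses say that block m, between the distances [n - m.+1] and
    [n - m], meets the strip of distances in (q - 1, q]. *)
Lemma floor_two_blocks (R : realType) (n m : nat) (q : R) :
  n%:R - m.+1%:R <= q -> q < n%:R - m%:R + 1 ->
  let l := n%:Z - 1 - Num.floor q in m%:Z = l \/ m%:Z = l + 1.
Proof.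
have := floor_itv q; set f := Num.floor q => /andP[fl fu] lo hi l.
have : n%:Z - m.+1%:Z < f + 1.
  by rewrite -(ltr_int R) intrB -!pmulrn; lra.
have : f < n%:Z - m%:Z + 1.
  by rewrite -(ltr_int R) intrD intrB -!pmulrn; lra.
by rewrite {}/l; clearbody f; clear; lia.
Qed.

Theorem corollary4 (R : realType) (D : link R) (dx : R) (i : nat)
    (Htri : triangular D)
    (Hn : (0 < nini D)%N)
    (Hdx : 0 < dx)
    (Hdt : 0 < dt D)
    (Hgrid : forall m : nat, (m <= nini D)%N -> node D m = xin D + m%:R * dx)
    (Hcfl : dt D <= dx / v D)
    (Hadm : admissible_blocks D)
    (Hcont : continuous_data D)
    (Hjunction : junction_flows D)
    (Hi : (1 <= i)%N) :
  let t := time D i in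
  let j := (i.-1)%:Z in
  let k := Num.floor ((t - (xout D - xin D) / v D) / dt D) in
  (* block containing the foot xout - v t of the free-flow characteristic;
     floor (v t / dx) counts the blocks from the downstream end *)
  let l := (nini D)%:Z - 1 - Num.floor (v D * t / dx) in
  demand_value D i =
    if t <= (xout D - xin D) / v D then
      Order.min (N_ini D l (xout D) t)
        (Order.min (N_ini D (l + 1) (xout D) t)
          (N_down D j (xout D) (time D i.-1)
             + (v D * kc D * dt D)%:E)%E)
    else
      Order.min
        (N_down D j (xout D) (time D i.-1)
           + (v D * kc D * dt D)%:E)%E
        (N_up D k (xout D) t).
Proof.
case: i Hi => // p _ t j k l; rewrite N_down_start // -EFinD /=.
have [v0 w0 kc0 _ _] := Htri.
have tS : t = time D p + dt D by rewrite /t timeS.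
have vtS : v D * t = v D * time D p + v D * dt D by rewrite tS mulrDr.
have vdt : v D * dt D <= dx by move: Hcfl; rewrite ler_pdivlMr // mulrC.
have L : xout D - xin D = (nini D)%:R * dx.
  by rewrite /xout Hgrid // addrC addKr.
have L_ge0 : 0 <= xout D - xin D by rewrite L mulr_ge0 // ltW.
have dem_ini z : (demand_value D p.+1 <= N_ini D z (xout D) t)%E.
  by rewrite /demand_value ge_min ini_value_le_N_ini.
have dem_up z : (demand_value D p.+1 <= N_up D z (xout D) t)%E.
  by rewrite /demand_value !ge_min up_component_le // orbT.
have dem_down : (demand_value D p.+1
    <= (pdown D p * time D p + cdown D p + v D * kc D * dt D)%:E)%E.
  by rewrite /demand_value !ge_min down_component // lexx !orbT.
have covered m y : in_block D m y -> xout D - y <= v D * time D p ->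
    pdown D p * time D p + cdown D p + v D * kc D * dt D
    <= ini_affine D m y + travel_cost D (xout D) t y 0.
  move=> my yT.
  have := junction_covers Htri Hdx Hdt Hgrid Hcont Hjunction my yT.
  by rewrite /travel_cost tS; lra.
have [_ cup _ c00 _] := Hcont.
have up0 : up_data D 0 = (ini_affine D 0 (xin D))%:E.
  have b0 : time D 0 <= 0 <= time D 1.
    by rewrite {1}/time mul0r lexx (time_ge0 Hdt).
  rewrite /up_data (glued_block Hdt cup b0).
  move: c00; rewrite /up_fun /ini_fun b0 Hn -[xin D]/(node D 0) lexx /=.
  by rewrite !Hgrid // lerD2l mul0r mul1r (ltW Hdx) => ->.
have in0 y : xin D <= y <= xin D + dx -> in_block D 0 y.
  by rewrite /in_block Hn /= !Hgrid // mul0r mul1r addr0.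
have block_ge m y : in_block D m y ->
    [/\ (m < nini D)%N, xin D + m%:R * dx <= y & y <= xin D + m.+1%:R * dx].
  by case/andP => mn; rewrite (Hgrid _ mn) (Hgrid _ (ltnW mn)) => /andP[].
rewrite ler_pdivlMr // [t * _]mulrC.
case: ifPn => [tL|]; last rewrite -ltNge => tL.
  apply/le_anti/andP; split; first by rewrite !le_min !dem_ini dem_down.
  set M := Order.min _ _.
  have le_ini m y : in_block D m y -> reaches D (xout D) t y 0 ->
      (M <= (ini_affine D m y + travel_cost D (xout D) t y 0)%:E)%E.
    move=> my cone.
    have [yT|yT] := leP (xout D - y) (v D * time D p).
      by rewrite /M !ge_min lee_fin covered // !orbT.
    have [mn m_y y_m] := block_ge _ _ my.
    have yt : xout D - y <= v D * t.
      by move: cone; rewrite /reaches subr0 => /andP[].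
    have m_l : m%:Z = l \/ m%:Z = l + 1.
      by apply: floor_two_blocks; rewrite ?ler_pdivlMr ?ltr_pdivrMr //; lra.
    by rewrite /M; case: m_l => <-; rewrite !ge_min N_ini_le // ?orbT.
  apply: demand_value_ge; rewrite -/t //;
    last by rewrite /M !ge_min lexx !orbT.
  move=> s cone.
  (* As [v * t] is at most the length of the link, the cone meets the inlet only
     at times [s <= 0]. At [s = 0] the upstream datum is the initial one. *)
  have s_le0 : s <= 0 by rewrite -(pmulr_rle0 _ v0); case/andP: cone => _; lra.
  move: s_le0 cone; rewrite le_eqVlt => /orP[/eqP ->|s_lt0] cone.
    by rewrite up0 -EFinD le_ini // in0 // lexx lerDl ltW.
  by rewrite /up_data (glued_lt0 Hdt) // addye // leey.
apply/le_anti/andP; split; first by rewrite le_min dem_down dem_up.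
set M := Order.min _ _.
set tau := t - (xout D - xin D) / v D in k M *.
(* [tau] is the time at which the free-flow characteristic through
   [(xout, t)] leaves the inlet. *)
have v_tau : v D * tau = v D * t - (xout D - xin D).
  by rewrite /tau; field; rewrite gt_eqF.
have v_gap : v D * (t - tau) = xout D - xin D by rewrite mulrBr v_tau; lra.
have tau0 : 0 <= tau by rewrite -(pmulr_rge0 _ v0) v_tau; lra.
have up_slope s : s <= tau ->
    (up_data D tau <= up_data D s + (v D * kc D * (tau - s))%:E)%E.
  by apply: glued_slope => // m; case: Hadm => _ /(_ m) /andP[].
have M_up : (M <= up_data D tau)%E.
  have k0 : 0 <= k by rewrite /k floor_ge0 divr_ge0 // ltW.
  have [q kq] : exists q : nat, k = q%:Z by exists `|k|%N; rewrite gez0_abs.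
  have q_tau := time_block_of_floor Hdt kq.
  have cone : reaches D (xout D) t (xin D) tau.
    rewrite /reaches v_gap lexx andbT (le_trans _ L_ge0) // mulNr oppr_le0.
    by rewrite mulr_ge0 ?(ltW w0) // -(pmulr_rge0 _ v0) v_gap.
  rewrite /M ge_min; apply/orP; right; rewrite kq.
  apply: le_trans (lax_hopf_le _ Htri cone) _.
  rewrite /up_data (glued_block Hdt cup q_tau) /up_block /imposed_at /=.
  rewrite eqxx /up_fun q_tau -EFinD lee_fin /travel_cost.
  by rewrite v_gap subrr mulr0 addr0.
apply: demand_value_ge; rewrite -/t //; last by rewrite /M ge_min lexx.
  move=> m y my cone.
  have [yT|yT] := leP (xout D - y) (v D * time D p).
    by rewrite /M ge_min lee_fin covered.
  have [mn m_y y_m] := block_ge _ _ my.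
  (* The inlet is already less than [v * t] away from the exit, so the strip
     ends within [dx] of the inlet. *)
  have m0 : m = 0%N.
    apply/eqP; rewrite -leqn0 -ltnS -(ltr_nat R) -(ltr_pM2r Hdx).
    by lra.
  move: my m_y y_m; rewrite {}m0 => my; rewrite mul0r mul1r addr0 => x0_y y_x1.
  (* The contribution of y has slope [kc - k_0] on block 0. *)
  have [k_kc|kc_k] := leP (kini D 0) (kc D).
    apply: le_trans M_up _; apply: le_trans (up_slope 0 tau0) _.
    rewrite up0 -EFinD lee_fin /ini_affine /travel_cost !subr0.
    have kc_k0 : 0 <= kc D - kini D 0 by rewrite subr_ge0.
    have y_x0 : 0 <= y - xin D by rewrite subr_ge0.
    have -> : v D * kc D * tau = kc D * (v D * tau) by ring.
    by rewrite v_tau; have := mulr_ge0 kc_k0 y_x0; lra.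
  pose y' := xout D - v D * time D p.
  have y_y' : 0 <= y' - y by rewrite /y'; lra.
  have k0_kc : 0 <= kini D 0 - kc D by rewrite subr_ge0 ltW.
  have y'_in : in_block D 0 y' by apply: in0; rewrite /y'; lra.
  have := covered _ _ y'_in; rewrite /M ge_min lee_fin => covered_y'.
  apply/orP; left; apply: le_trans (covered_y' _) _; first by rewrite /y'; lra.
  by rewrite /ini_affine /travel_cost; have := mulr_ge0 k0_kc y_y'; lra.
(* Upstream data emitted up to [tau] are dominated by the datum at [tau]. *)
move=> s cone; have s_tau : s <= tau.
  by rewrite -(ler_pM2l v0) v_tau; case/andP: cone => _; lra.
apply: le_trans M_up _; apply: le_trans (up_slope s s_tau) _.
apply: leeD2l; rewrite lee_fin /travel_cost.
have -> : v D * kc D * (tau - s) = kc D * (v D * tau - v D * s) by ring.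
by rewrite v_tau; lra.
Qed.
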